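(* The tree returned by the Minimal Proof Search (MPS) algorithm, run on a state $q$ and a formula $\phi$, contains a proof or a disproof that $q\models\phi$ of minimal cost (a proof whose cost $K$ is minimal among all proofs that $q\models\phi$, or a disproof whose cost $K$ is minimal among all disproofs that $q\models\phi$).
   Context: **Game automata and formulas.** A game automaton is a tuple $G=(P,\Sigma,Q,\pi,\delta)$: $P$ a non-empty set of atoms, $\Sigma$ a non-empty finite set of agents, $Q$ a set of game states, $\pi:Q\to 2^P$, $\delta:Q\times\Sigma\to 2^Q$. Write $q\xrightarrow{a}q'$ when $q'\in\delta(q,a)$; $\delta(q,a)=\emptyset$ is allowed. MMLK formulas: $\phi ::= p \mid \neg\phi' \mid \Box_a\phi' \mid \phi_1\wedge\phi_2$ with $p\in P$, $a\in\Sigma$. Satisfaction: $q\models p$ if $p\in\pi(q)$; $q\models\neg\phi$ if $q\not\models\phi$; $q\models\phi_1\wedge\phi_2$ if $q\models\phi_1$ and $q\models\phi_2$; $q\models\Box_a\phi$ if $q'\models\phi$ for all $q'$ with $q\xrightarrow{a}q'$. A game automaton is fixed. **Costs.** $\mathbb{R}^+$ denotes the nonnegative reals and $\mathbb{N}^{\mathbb{R}^+\cup\{\infty\}}$ the set of multisets of elements of $\mathbb{R}^+\cup\{\infty\}$. Given are a base cost function $k:P\to\mathbb{R}^+$, a conjunction cost aggregator $A_\wedge:\mathbb{N}^{\mathbb{R}^+\cup\{\infty\}}\to\mathbb{R}^+\cup\{\infty\}$ and a box cost aggregator $A_\Box:\Sigma\times\mathbb{N}^{\mathbb{R}^+\cup\{\infty\}}\to\mathbb{R}^+\cup\{\infty\}$.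 Assumptions, where $A$ stands for $A_\wedge$ or for $A_\Box(a,\cdot)$ with any $a\in\Sigma$: (i) for all $x\le y$ in $\mathbb{R}^+\cup\{\infty\}$ and all multisets $X$, $A(X)\le A(\{x\}\cup X)\le A(\{y\}\cup X)$; (ii) aggregating infinite costs results in infinite costs and aggregating finite numbers of finite costs results in finite costs: $A(\{\infty\})=\infty$, and for all $x\in\mathbb{R}^+$ and multisets $X$, $A(X)<\infty$ implies $A(\{x\}\cup X)<\infty$. **Heuristics.** $I(p)=J(p)=k(p)$; $I(\neg\phi')=J(\phi')$, $J(\neg\phi')=I(\phi')$; $I(\phi_1\wedge\phi_2)=A_\wedge(\{I(\phi_1),I(\phi_2)\})$, $J(\phi_1\wedge\phi_2)=\min_{i\in\{1,2\}}A_\wedge(\{J(\phi_i)\})$; $I(\Box_a\phi')=A_\Box(a,\emptyset)$, $J(\Box_a\phi')=A_\Box(a,\{J(\phi')\})$. **Exploration trees.** An exploration tree for $\phi$ in $q$ is a tree whose nodes are associated with (labelled by) pairs (state, formula), with root associated with $(q,\phi)$, such that: a node associated with $(q,p)$, $p\in P$, has no children; a node associated with $(q,\neg\phi)$ has at most one child, and it is an exploration tree associated with $(q,\phi)$; any child of a node associated with $(q,\phi_1\wedge\phi_2)$ is an exploration tree associated with $(q,\phi_1)$ or with $(q,\phi_2)$; any child of a node associated with $(q,\Box_a\phi)$ is an exploration tree associated with $(q',\phi)$ for some $q'$ with $q\xrightarrow{a}q'$; in any case, no two children of a node are associated with the same pair. A tree is identified with its root. **Proofs and disproofs.** A proof (resp.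 disproof) that $q\models\phi$ is an exploration tree with root $n$ associated with $(q,\phi)$ such that: if $\phi=p$, then $p\in\pi(q)$ (resp. $p\notin\pi(q)$); if $\phi=\neg\phi'$, then $n$ has exactly one child, and this child is a disproof (resp. proof); if $\phi=\phi_1\wedge\phi_2$, then $n$ has exactly two children $n_1,n_2$, with $n_1$ a proof that $q\models\phi_1$ and $n_2$ a proof that $q\models\phi_2$ (resp. $n$ has exactly one child, which is a disproof that $q\models\phi_1$ or a disproof that $q\models\phi_2$); if $\phi=\Box_a\phi'$, then $n$ has exactly one child $n'$ for each $q\xrightarrow{a}q'$, and $n'$ is a proof that $q'\models\phi'$ (resp. $n$ has exactly one child, which is a disproof that $q'\models\phi'$ for some $q\xrightarrow{a}q'$). **Cost of a (dis)proof.** For a node $n$ of a proof or disproof with set of children $C$: $K(n)=k(p)$ if $n$ is labelled $(q,p)$; $K(n)=K(c)$ if labelled $(q,\neg\phi)$ with child $c$; $K(n)=A_\wedge(\{K(c)\mid c\in C\})$ if labelled $(q,\phi_1\wedge\phi_2)$; $K(n)=A_\Box(a,\{K(c)\mid c\in C\})$ if labelled $(q,\Box_a\phi)$. **Effort numbers.** The information (info) attached to a node $n$ is a pair $(\mathrm{MPN}(n),\mathrm{MDN}(n))$ (minimal proof number, minimal disproof number). Terminal nodes (procedure info-term): a node labelled $(q,p)$ gets $(k(p),\infty)$ if $p\in\pi(q)$ and $(\infty,k(p))$ if $p\notin\pi(q)$. Newly created leaves (procedure init-leaf): a leaf labelled $(q,\phi)$ gets $(I(\phi),J(\phi))$. Heredity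 rule for internal nodes with set of children $C$: label $(q,\neg\phi)$ with child $c$: $(\mathrm{MDN}(c),\mathrm{MPN}(c))$; label $(q,\phi_1\wedge\phi_2)$: $\mathrm{MPN}=A_\wedge(\{\mathrm{MPN}(c)\mid c\in C\})$ and $\mathrm{MDN}=\min_{c\in C}A_\wedge(\{\mathrm{MDN}(c)\})$; label $(q,\Box_a\phi)$: $\mathrm{MPN}=A_\Box(a,\{\mathrm{MPN}(c)\mid c\in C\})$ and $\mathrm{MDN}=\min_{c\in C}A_\Box(a,\{\mathrm{MDN}(c)\})$. A node is solved if its MPN or its MDN is $\infty$. **MPS.** On input $(q,\phi)$: create a root $r$ labelled $(q,\phi)$ with info init-leaf$(r)$ and set $n:=r$. While $r$ is not solved: (1) while $n$ is not a leaf, set $n:=$ select-child$(n)$; (2) extend$(n)$; (3) set $n:=$ backpropagate$(n)$. Return $r$. Here select-child returns the only child at a node labelled $(q,\neg\phi)$, a child $c$ minimizing $A_\wedge(\{\mathrm{MDN}(c)\})$ at a node labelled $(q,\phi_1\wedge\phi_2)$, and a child $c$ minimizing $A_\Box(a,\{\mathrm{MDN}(c)\})$ at a node labelled $(q,\Box_a\phi)$. The procedure extend$(n)$ sets the info of $n$ to info-term$(n)$ if $n$ is labelled $(q,p)$, and otherwise adds new children with info init-leaf: two, labelled $(q,\phi_1)$ and $(q,\phi_2)$, if $n$ is labelled $(q,\phi_1\wedge\phi_2)$; one, labelled $(q,\phi_1)$, if $n$ is labelled $(q,\neg\phi_1)$; one labelled $(q',\phi_1)$ for each $q'$ with $q\xrightarrow{a}q'$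 if $n$ is labelled $(q,\Box_a\phi_1)$. The procedure backpropagate$(n)$ determines the new info of $n$ by the rules for effort numbers (the heredity rule for internal nodes); if this equals the current info of $n$ or if $n=r$, it returns $n$; otherwise it sets the info of $n$ to the new info and returns backpropagate(parent of $n$).
   Formalization: Read literally, φ∧φ has no proof and MPS need not stop. Here equal conjuncts get separate children, backpropagate compares with the info before extend and also stores the root's info, A(∅) is assumed finite, and trees are finitely branching. *)

(* Defs.v *)
From Stdlib Require Import Relation_Operators.
From Stdlib Require List.
From mathcomp Require Import all_boot all_order all_algebra.
From mathcomp Require Import finmap multiset.
From mathcomp Require Import all_classical reals constructive_ereal.
From mathcomp Require Import interval_inference.

Set Implicit Arguments.
Unset Strict Implicit.
Unset Printing Implicit Defensive.

Import Order.TTheory GRing.Theory Num.Theory.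
Local Open Scope classical_set_scope.
Local Open Scope ring_scope.
Local Open Scope ereal_scope.
Local Open Scope mset_scope.

Record game_automaton := GameAutomaton {
  atom : Type;
  agent : finType;
  gstate : Type;
  atom_inhabited : inhabited atom;
  agent_inhabited : inhabited agent;
  valuation : gstate -> set atom;
  succ : gstate -> agent -> set gstate
}.

Inductive formula (G : game_automaton) : Type :=
| Atom of atom G
| Neg of formula G
| Box of agent G & formula G
| And of formula G & formula G.

(* The nonnegative reals together with +oo. *)
Notation cost R := {nonneg \bar R}.

Definition cost_fin (R : realType) (x : {nonneg R}) : cost R :=
  (x%:num%:E)%:nng.
Definition cost_oo (R : realType) : cost R := +oo%:nng.
Definition cost_0 (R : realType) : cost R := cost_fin (0%:nng)%R.

(* [agg_finite] includes the aggregation of no cost at all, A(mset0) < +oo,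
   which does not follow from [agg_finite_add]. *)
Record cost_aggregator (R : realType) (A : {mset cost R} -> cost R) : Prop :=
  CostAggregator {
  agg_monotone : forall (x y : cost R) (X : {mset cost R}), (x <= y)%O ->
    (A X <= A (x +` X))%O /\ (A (x +` X) <= A (y +` X))%O;
  agg_oo : A [mset cost_oo R] = cost_oo R;
  agg_finite_add : forall (x : {nonneg R}) (X : {mset cost R}),
    (A X < cost_oo R)%O -> (A (cost_fin x +` X) < cost_oo R)%O;
  agg_finite : forall X : {mset cost R},
    (forall x, x \in X -> (x < cost_oo R)%O) -> (A X < cost_oo R)%O
}.

Record cost_model (R : realType) (G : game_automaton) := CostModel {
  base_cost : atom G -> {nonneg R};
  agg_and : {mset cost R} -> cost R;
  agg_box : agent G -> {mset cost R} -> cost R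
}.

Inductive tree (A : Type) : Type := Node of A & seq (tree A).

Definition root_label (A : Type) (t : tree A) : A := let: Node a _ := t in a.
Definition children (A : Type) (t : tree A) : seq (tree A) :=
  let: Node _ cs := t in cs.

Fixpoint tree_map (A B : Type) (f : A -> B) (t : tree A) : tree B :=
  let: Node a cs := t in Node (f a) (map (tree_map f) cs).

(* [pruned t t']: t' is obtained from t by deleting some of the branches below
   the root, i.e. t contains t' (as a tree with the same root). *)
Inductive pruned (A : Type) : tree A -> tree A -> Prop :=
| PrunedNode a cs ds : pruned_seq cs ds -> pruned (Node a cs) (Node a ds)
with pruned_seq (A : Type) : seq (tree A) -> seq (tree A) -> Prop :=
| PrunedNil : pruned_seq [::] [::]
| PrunedKeep c d cs ds :
    pruned c d -> pruned_seq cs ds -> pruned_seq (c :: cs) (d :: ds)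
| PrunedDrop c cs ds : pruned_seq cs ds -> pruned_seq (c :: cs) ds.

Definition enumerates (T : Type) (s : seq T) (A : set T) : Prop :=
  List.NoDup s /\ forall x, List.In x s <-> A x.

Section Proofs.
Context (R : realType) (G : game_automaton) (C : cost_model R G).
Implicit Types (q : gstate G) (phi : formula G).

Definition label_tree := tree (gstate G * formula G).
Implicit Types t : label_tree.

(* Below a conjunction phi /\ phi with twice the same conjunct, the two
   occurrences of phi count as distinct: each may have its own child, although
   both children carry the same pair (otherwise phi /\ phi would have no
   proof).  When f1 <> f2 the bound on the number of children is implied by
   the absence of duplicates. *)
Fixpoint exploration_tree phi q t {struct phi} : Prop :=
  root_label t = (q, phi) /\
  match phi with
  | Atom _ => children t = [::]
  | Neg f => children t = [::] \/
      exists c, children t = [:: c] /\ exploration_tree f q c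
  | And f1 f2 =>
      [/\ forall c, List.In c (children t) ->
            exploration_tree f1 q c \/ exploration_tree f2 q c,
          f1 <> f2 -> List.NoDup (map (@root_label _) (children t)) &
          (size (children t) <= 2)%N]
  | Box a f =>
      (forall c, List.In c (children t) ->
         exists q', succ q a q' /\ exploration_tree f q' c) /\
      List.NoDup (map (@root_label _) (children t))
  end.

Fixpoint is_proof phi q t {struct phi} : Prop :=
  exploration_tree phi q t /\
  match phi with
  | Atom p => valuation q p
  | Neg f => exists c, children t = [:: c] /\ is_disproof f q c
  | And f1 f2 => exists c1 c2,
      [/\ children t = [:: c1; c2] \/ children t = [:: c2; c1],
          is_proof f1 q c1 & is_proof f2 q c2]
  | Box a f => exists s, enumerates s (succ q a) /\
      List.Forall2 (fun q' c => is_proof f q' c) s (children t)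
  end
with is_disproof phi q t {struct phi} : Prop :=
  exploration_tree phi q t /\
  match phi with
  | Atom p => ~ valuation q p
  | Neg f => exists c, children t = [:: c] /\ is_proof f q c
  | And f1 f2 => exists c,
      children t = [:: c] /\ (is_disproof f1 q c \/ is_disproof f2 q c)
  | Box a f => exists c q',
      [/\ children t = [:: c], succ q a q' & is_disproof f q' c]
  end.

(* Only meaningful on (dis)proofs: a negation node there has one child, so that
   the default value of [head] is never used. *)
Fixpoint proof_cost t : cost R :=
  let: Node (_, phi) cs := t in
  let Ks := map proof_cost cs in
  match phi with
  | Atom p => cost_fin (base_cost C p)
  | Neg _ => head (cost_0 R) Ks
  | And _ _ => agg_and C (seq_mset Ks)
  | Box a _ => agg_box C a (seq_mset Ks)
  end.

Definition contains_minimal (isP : label_tree -> Prop) t : Prop :=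
  exists d, [/\ pruned t d, isP d &
    forall d', isP d' -> (proof_cost d <= proof_cost d')%O].

End Proofs.

Section MPS.
Context (R : realType) (G : game_automaton) (C : cost_model R G).
Implicit Types (q : gstate G) (phi : formula G).

Fixpoint heurI phi : cost R :=
  match phi with
  | Atom p => cost_fin (base_cost C p)
  | Neg f => heurJ f
  | And f1 f2 => agg_and C [mset heurI f1; heurI f2]
  | Box a _ => agg_box C a mset0
  end
with heurJ phi : cost R :=
  match phi with
  | Atom p => cost_fin (base_cost C p)
  | Neg f => heurI f
  | And f1 f2 =>
      Order.min (agg_and C [mset heurJ f1]) (agg_and C [mset heurJ f2])
  | Box a f => agg_box C a [mset heurJ f]
  end.

(* (MPN, MDN) *)
Definition info : Type := (cost R * cost R)%type.

Definition search_tree := tree (gstate G * formula G * info).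
Implicit Types n : search_tree.

Definition node_info n : info := (root_label n).2.
Definition MPN n : cost R := (node_info n).1.
Definition MDN n : cost R := (node_info n).2.
Definition set_info n (i : info) : search_tree :=
  Node ((root_label n).1, i) (children n).
Definition solved n : bool :=
  (MPN n == cost_oo R) || (MDN n == cost_oo R).

Definition erase_info n : label_tree G := tree_map fst n.

Definition info_term q (p : atom G) : info :=
  if `[< valuation q p >] then (cost_fin (base_cost C p), cost_oo R)
  else (cost_oo R, cost_fin (base_cost C p)).

Definition init_leaf q phi : search_tree :=
  Node (q, phi, (heurI phi, heurJ phi)) [::].

(* Only applied to extended nodes: the default value at a negation is never
   used.  A minimum over no child is +oo. *)
Definition new_info n : info :=
  let: Node (q, phi, _) cs := n in
  match phi with
  | Atom p => info_term q p
  | Neg _ => head (cost_0 R, cost_0 R) [seq (MDN c, MPN c) | c <- cs]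
  | And _ _ =>
      (agg_and C (seq_mset (map MPN cs)),
       \big[Order.min/cost_oo R]_(c <- cs) agg_and C [mset MDN c])
  | Box a _ =>
      (agg_box C a (seq_mset (map MPN cs)),
       \big[Order.min/cost_oo R]_(c <- cs) agg_box C a [mset MDN c])
  end.

(* A configuration consists of the current tree and the current node n of the
   search, as a zipper: n itself, preceded by its proper ancestors starting
   from the parent, each with the siblings to the left and to the right of the
   child on the path to n. *)
Record frame := Frame {
  frame_label : gstate G * formula G * info;
  frame_left : seq search_tree;
  frame_right : seq search_tree
}.

Definition plug (f : frame) n : search_tree :=
  Node (frame_label f) (frame_left f ++ n :: frame_right f).

Definition config : Type := (seq frame * search_tree)%type.

Definition config_root (c : config) : search_tree :=
  foldl (fun n f => plug f n) c.2 c.1.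

(* Ties between children are broken arbitrarily. *)
Definition selectable phi n (cs : seq search_tree) : Prop :=
  match phi with
  | Atom _ => False
  | Neg _ => cs = [:: n]
  | And _ _ => forall n', List.In n' cs ->
      (agg_and C [mset MDN n] <= agg_and C [mset MDN n'])%O
  | Box a _ => forall n', List.In n' cs ->
      (agg_box C a [mset MDN n] <= agg_box C a [mset MDN n'])%O
  end.

Inductive select_child : config -> config -> Prop :=
| SelectChild fs q phi i l n r :
    selectable phi n (l ++ n :: r) ->
    select_child (fs, Node (q, phi, i) (l ++ n :: r))
                 (Frame (q, phi, i) l r :: fs, n).

Inductive extend : search_tree -> search_tree -> Prop :=
| ExtendAtom q p i :
    extend (Node (q, Atom p, i) [::]) (Node (q, Atom p, info_term q p) [::])
| ExtendNeg q f i :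
    extend (Node (q, Neg f, i) [::]) (Node (q, Neg f, i) [:: init_leaf q f])
| ExtendAnd q f1 f2 i :
    extend (Node (q, And f1 f2, i) [::])
           (Node (q, And f1 f2, i) [:: init_leaf q f1; init_leaf q f2])
| ExtendBox q a f i s :
    enumerates s (succ q a) ->
    extend (Node (q, Box a f, i) [::])
           (Node (q, Box a f, i) [seq init_leaf q' f | q' <- s]).

(* [old] is the info that the current node n had before this iteration: the
   info to compare with is the one preceding [extend], since at an atom
   [extend] already stores the new info.  The new info is stored at the root
   too, which is where the test of termination reads it. *)
Fixpoint backpropagate (old : info) (fs : seq frame) n : config :=
  let i := new_info n in
  let n' := set_info n i in
  if fs is f :: fs' then
    if i == old then (fs, n')
    else backpropagate (frame_label f).2 fs' (plug f n')
  else ([::], n').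

Inductive mps_iteration : config -> config -> Prop :=
| MpsIteration c fs n n' :
    ~~ solved (config_root c) ->
    clos_refl_trans_1n config select_child c (fs, n) ->
    children n = [::] ->
    extend n n' ->
    mps_iteration c (backpropagate (node_info n) fs n').

Definition mps_init q phi : config := ([::], init_leaf q phi).

Definition mps_returns q phi (r : search_tree) : Prop :=
  exists c, [/\ clos_refl_trans_1n config mps_iteration (mps_init q phi) c,
                solved (config_root c) & r = config_root c].

(* Every run from c is finite and ends with a solved root. *)
Inductive mps_halts (c : config) : Prop :=
| MpsHalts of (~~ solved (config_root c) -> exists c', mps_iteration c c')
    & (forall c', mps_iteration c c' -> mps_halts c').

End MPS.

(* Main.v *)
(* When an unsolved node n on the current path changes, either n stays unsolved,
   or one of its two numbers becomes infinite and the other one is unchanged.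
   This propagates from a child to its parent because the selected child
   realises the minimum that defines MDN. Hence, in a node that has just been
   disproved, the disproved child realises the minimal disproof number, and
   (dis)proofs whose cost is the finite number of the root are read off the tree
   by following these children. Effort numbers are lower bounds for the costs of
   all (dis)proofs, by induction on the formula, so the extracted one is minimal.
   Every iteration extends a leaf, which decreases the total size of the full
   exploration trees that remain below the unsolved leaves. *)
From Stdlib Require Import Relation_Operators.
From Stdlib Require List Permutation.
Require Import Defs.
From mathcomp Require Import all_boot all_order all_algebra.
From mathcomp Require Import finmap multiset.
From mathcomp Require Import all_classical reals constructive_ereal.
From mathcomp Require Import interval_inference.

Set Implicit Arguments.
Unset Strict Implicit.
Unset Printing Implicit Defensive.

Import Order.TTheory.
Local Open Scope mset_scope.

(** * Lists, multisets, pruned forests and enumerations of finite sets *)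

Lemma Forall2_map_l (S T U : Type) (P : U -> T -> Prop) (g : S -> U) s t :
  List.Forall2 P (map g s) t <-> List.Forall2 (fun x y => P (g x) y) s t.
Proof.
split; last by elim=> [|x y s' t' Pxy _ IH] /=; constructor.
elim: s t => [|x s IH] t /= H; first by inversion H; constructor.
by inversion H; subst; constructor; last exact: IH.
Qed.

Lemma Forall2_in_r (S T : Type) (P : S -> T -> Prop) s t y :
  List.Forall2 P s t -> List.In y t -> exists2 x, List.In x s & P x y.
Proof.
elim=> [//|x z s' t' Pxz _ IH] /= [<-|/IH [w ? ?]]; first by exists x; [left|].
by exists w; [right|].
Qed.

Lemma Forall2_in_l (S T : Type) (P : S -> T -> Prop) s t x :
  List.Forall2 P s t -> List.In x s -> exists2 y, List.In y t & P x y.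
Proof.
elim=> [//|z y s' t' Pxz _ IH] /= [<-|/IH [w ? ?]]; first by exists y; [left|].
by exists w; [right|].
Qed.

Lemma Forall2_impl_in (S T : Type) (P Q : S -> T -> Prop) s t :
  (forall x y, List.In x s -> List.In y t -> P x y -> Q x y) ->
  List.Forall2 P s t -> List.Forall2 Q s t.
Proof.
move=> PQ st; elim: st PQ => [|x y s' t' Pxy _ IH] PQ; constructor.
  by apply: PQ => //; left.
by apply: IH => x' y' ? ?; apply: PQ; right.
Qed.

Lemma Permutation_perm_eq (T : eqType) (s t : seq T) :
  Permutation.Permutation s t -> perm_eq s t.
Proof.
elim=> //= [x s' t' _ IH|x y s'|s1 s2 s3 _ IH1 _ IH2].
- by rewrite perm_cons.
- by rewrite (perm_catCA [:: y] [:: x]).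
- exact: perm_trans IH1 IH2.
Qed.

Lemma seq_mset_nil (K : choiceType) : seq_mset [::] = mset0 :> {mset K}.
Proof. by apply/msetP => x; rewrite mset_seqE mset0E. Qed.

Lemma seq_mset1 (K : choiceType) (x : K) : seq_mset [:: x] = [mset x].
Proof. by rewrite mset_cons seq_mset_nil msetD0. Qed.

Lemma seq_mset2 (K : choiceType) (x y : K) : seq_mset [:: x; y] = [mset x; y].
Proof. by rewrite mset_cons seq_mset1. Qed.

Lemma in_cat_cons (T : Type) (x : T) s t : List.In x (s ++ x :: t).
Proof. by apply: List.in_or_app; right; left. Qed.

Lemma pruned_seq_all (T : Type) (cs : seq (tree T)) : pruned_seq cs [::].
Proof. by elim: cs => [|c cs IH]; constructor. Qed.

Lemma pruned_seq_single (T : Type) (cs : seq (tree T)) (c d : tree T) :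
  List.In c cs -> pruned c d -> pruned_seq cs [:: d].
Proof.
move=> + cd; elim: cs => [//|e cs IH] [->|/IH]; last exact: PrunedDrop.
by apply: PrunedKeep => //; exact: pruned_seq_all.
Qed.

Lemma finite_enumerates (T : Type) (X : set T) :
  finite_set X -> exists s, enumerates s X.
Proof.
(* Over [{classic T}] membership is boolean, so that a finite set is given by a sequence, from which
   [undup] removes the repetitions. *)
have inP (x : {classic T}) (s : seq {classic T}) : reflect (List.In x s) (x \in s).
  elim: s => [|y s IH]; first by constructor.
  rewrite inE; apply: (iffP orP) => [[/eqP ->|/IH]|[->|/IH]];
    by [left|right|left; apply/eqP|right].
move=> /(@finite_seqP {classic T}) [s ->]; exists (undup s); split.
  elim: s => [|x s IH] /=; first by constructor.
  case: ifPn => // x_s; constructor=> //; rewrite -mem_undup in x_s.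
  by move=> x_in; move/negP: x_s; apply; apply/inP.
move=> x; split=> [/inP|x_s]; first by rewrite mem_undup.
by apply/inP; rewrite mem_undup.
Qed.

(** * Extended costs, their minima and their aggregators *)

Section Cost.
Context (R : realType).
Implicit Types x y z : cost R.

Lemma cost_comparable x y : (x >=< y)%O.
Proof. exact: (@le_total _ _ x%:num%R y%:num%R). Qed.

Lemma le_cost_oo x : (x <= cost_oo R)%O.
Proof. exact: (leey x%:num%R). Qed.

Lemma lt_cost_oo x : (x < cost_oo R)%O = (x != cost_oo R).
Proof. by rewrite lt_neqAle le_cost_oo andbT. Qed.

Lemma cost_oo_le x : (cost_oo R <= x)%O -> x = cost_oo R.
Proof. by move=> le_x; apply/le_anti; rewrite le_cost_oo. Qed.

Lemma le_bigmin_cost (T : Type) (F : T -> cost R) (s : seq T) z :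
  (z <= \big[Order.min/cost_oo R]_(c <- s) F c)%O <->
  forall c, List.In c s -> (z <= F c)%O.
Proof.
elim: s => [|c s IH]; first by rewrite big_nil le_cost_oo.
rewrite big_cons (comparable_le_min _ (cost_comparable _ _)); split.
  by move=> /andP[zc /IH zs] d /= [<-|/zs].
by move=> zs; apply/andP; split; [apply: zs; left|apply/IH => d ?; apply: zs; right].
Qed.

Lemma bigmin_cost_le (T : Type) (F : T -> cost R) (s : seq T) c :
  List.In c s -> (\big[Order.min/cost_oo R]_(d <- s) F d <= F c)%O.
Proof. exact: (proj1 (le_bigmin_cost F s _) (lexx _)). Qed.

Lemma bigmin_cost_eq (T : Type) (F : T -> cost R) (s : seq T) c :
  List.In c s -> (forall d, List.In d s -> (F c <= F d)%O) ->
  \big[Order.min/cost_oo R]_(d <- s) F d = F c.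
Proof.
by move=> cs cmin; apply/le_anti; rewrite bigmin_cost_le //=; apply/le_bigmin_cost.
Qed.

Lemma exists_min_cost (T : Type) (F : T -> cost R) (s : seq T) : s <> [::] ->
  exists2 c, List.In c s & forall d, List.In d s -> (F c <= F d)%O.
Proof.
elim: s => // c [|d s] IH _; first by exists c; [left|move=> ? [<-|]].
have [//|e es emin] := IH.
have /orP[ce|ec] := cost_comparable (F c) (F e).
  exists c; first by left.
  by move=> e' [<- //|/emin]; apply: le_trans.
by exists e; [right|move=> e' [<- //|/emin]].
Qed.

Context (A : {mset cost R} -> cost R) (hA : cost_aggregator A).

Lemma agg_le (s t : seq (cost R)) :
  List.Forall2 (fun x y => (x <= y)%O) s t ->
  (A (seq_mset s) <= A (seq_mset t))%O.
Proof.
(* The added empty multiset is generalised in the induction to a [Z] that collects the elements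
   already replaced. *)
rewrite -[seq_mset s]msetD0 -[seq_mset t]msetD0 => st.
elim: st (mset0 : {mset cost R}) => // x y s' t' xy _ IH Z.
rewrite !mset_cons -!msetDA.
apply: le_trans ((agg_monotone hA _ xy).2) _.
by rewrite !(msetDCA [mset y]); exact: IH.
Qed.

Lemma agg1_le x y : (x <= y)%O -> (A [mset x] <= A [mset y])%O.
Proof.
by move=> xy; rewrite -!seq_mset1; apply: agg_le; constructor; last constructor.
Qed.

Lemma agg_mset0_le (s : seq (cost R)) : (A mset0 <= A (seq_mset s))%O.
Proof.
elim: s => [|x s IH]; first by rewrite seq_mset_nil.
by rewrite mset_cons; exact: le_trans IH (agg_monotone hA _ (lexx x)).1.
Qed.

Lemma agg_perm (s t : seq (cost R)) :
  perm_eq s t -> A (seq_mset s) = A (seq_mset t).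
Proof. by move=> /eq_seq_msetP ->. Qed.

(** Enlarging the multiset that consists of one infinite cost cannot lower its infinite aggregate,
    while finite costs have a finite aggregate. Infinity can thus be traced through an aggregator by
    membership alone. *)
Lemma agg_seq_eq_oo (s : seq (cost R)) :
  (A (seq_mset s) == cost_oo R) = (cost_oo R \in s).
Proof.
have mem_s x : (x \in seq_mset s) = (x \in s).
  exact: (perm_mem (perm_eq_seq_mset s)).
apply/idP/idP => [|oo_s]; last first.
  apply/eqP/cost_oo_le; rewrite -[leLHS](agg_oo hA).
  rewrite (agg_perm (perm_to_rem oo_s)) mset_cons.
  elim: (rem _ s) => [|x t IH]; first by rewrite seq_mset_nil msetD0.
  rewrite mset_cons msetDCA.
  exact: le_trans IH (agg_monotone hA _ (lexx x)).1.
apply: contraLR => oo_s; rewrite -lt_cost_oo; apply: (agg_finite hA) => x.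
by rewrite mem_s lt_cost_oo; apply: contraTneq => ->.
Qed.

Lemma agg1_eq_oo x : (A [mset x] == cost_oo R) = (x == cost_oo R).
Proof. by rewrite -seq_mset1 agg_seq_eq_oo inE eq_sym. Qed.

End Cost.

(** * Search trees with consistent effort numbers *)

Section Sound.
Context (R : realType) (G : game_automaton) (C : cost_model R G).
Context (hAnd : cost_aggregator (agg_and C)).
Context (hBox : forall a : agent G, cost_aggregator (agg_box C a)).
Implicit Types (q : gstate G) (phi : formula G) (n c : search_tree R G).
Implicit Types (l : gstate G * formula G) (fs : seq (frame R G)).

(** A relation and not a function, since the successors at a box can be enumerated in any order, or
    in none if there are infinitely many. *)
Definition expands l (ls : seq (gstate G * formula G)) : Prop :=
  match l.2 with
  | Atom _ => ls = [::]
  | Neg f => ls = [:: (l.1, f)]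
  | And f1 f2 => ls = [:: (l.1, f1); (l.1, f2)]
  | Box a f => exists2 s, enumerates s (succ l.1 a) & ls = [seq (q', f) | q' <- s]
  end.

Definition branching phi : bool :=
  match phi with And _ _ | Box _ _ => true | _ => false end.

(* Meaningful at conjunctions and boxes only. *)
Definition aggregator phi : {mset cost R} -> cost R :=
  if phi is Box a _ then agg_box C a else agg_and C.

(* A disproof of minimal cost is found below the same child that realises the
   minimal disproof number. *)
Definition witnessed n : Prop :=
  branching (root_label n).1.2 -> MPN n = cost_oo R ->
  exists c, [/\ List.In c (children n), MPN c = cost_oo R &
    MDN n = aggregator (root_label n).1.2 [mset MDN c]].

(** The invariant of search trees. A node without children is either a fresh leaf, bearing heuristic
    values, or a [SoundNode] with nothing to expand: an evaluated atom or an extended box without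
    successors. *)
Inductive sound : gstate G * formula G -> search_tree R G -> Prop :=
| SoundLeaf q phi : sound (q, phi) (init_leaf C q phi)
| SoundNode q phi i ls cs :
    expands (q, phi) ls -> List.Forall2 sound ls cs ->
    i = new_info C (Node (q, phi, i) cs) ->
    witnessed (Node (q, phi, i) cs) ->
    sound (q, phi) (Node (q, phi, i) cs).

Lemma aggregatorP phi : cost_aggregator (aggregator phi).
Proof. by case: phi => *; [exact: hAnd|exact: hAnd|exact: hBox|exact: hAnd]. Qed.

(** Structural induction on the formula, with the state varying. It replaces induction on nested
    trees, because a sound tree descends to a subformula at each edge. *)
Lemma expands_ind (P : gstate G * formula G -> Prop) :
  (forall l, (forall ls, expands l ls -> forall m, List.In m ls -> P m) -> P l) ->
  forall l, P l.
Proof.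
move=> IH [q phi]; elim: phi q => [p|f IHf|a f IHf|f1 IH1 f2 IH2] q; apply: IH.
- by move=> ls ->.
- by move=> ls -> m [<-|[]].
- by move=> ls [s _ ->] m /List.in_map_iff [q' [<- _]].
- by move=> ls -> m [<-|[<-|[]]].
Qed.

Lemma new_info_branching q phi i cs : branching phi ->
  new_info C (Node (q, phi, i) cs) =
    (aggregator phi (seq_mset (map (@MPN _ _) cs)),
     \big[Order.min/cost_oo R]_(c <- cs) aggregator phi [mset MDN c]).
Proof. by case: phi. Qed.

Lemma sound_label l n : sound l n -> (root_label n).1 = l.
Proof. by case. Qed.

Lemma solvedN n : ~~ solved n = (MPN n != cost_oo R) && (MDN n != cost_oo R).
Proof. by rewrite negb_or. Qed.

(** Base costs are finite and aggregators preserve finiteness, also on the empty multiset that a box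
    uses. Hence a fresh leaf is never solved. *)
Lemma heur_neq_oo phi :
  (heurI C phi != cost_oo R) && (heurJ C phi != cost_oo R).
Proof.
elim: phi => [p|f /andP[fI fJ]|a f /andP[fI fJ]|f1 /andP[I1 J1] f2 /andP[I2 J2]] /=.
- by [].
- by rewrite fI fJ.
- by rewrite -seq_mset_nil (agg_seq_eq_oo (hBox a)) in_nil (agg1_eq_oo (hBox a)).
- rewrite -seq_mset2 (agg_seq_eq_oo hAnd) !inE !(eq_sym (cost_oo R)).
  rewrite (negPf I1) (negPf I2) /= /Order.min.
  by case: ifP => _; rewrite (agg1_eq_oo hAnd).
Qed.

Lemma init_leaf_unsolved q phi : ~~ solved (init_leaf C q phi).
Proof. by rewrite solvedN; exact: heur_neq_oo. Qed.

(** * Heuristics and effort numbers as lower bounds of costs *)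

Lemma is_proof_exploration phi q t : is_proof phi q t -> exploration_tree phi q t.
Proof. by case: phi => [?|?|??|??] []. Qed.

Lemma is_disproof_exploration phi q t :
  is_disproof phi q t -> exploration_tree phi q t.
Proof. by case: phi => [?|?|??|??] []. Qed.

Lemma exploration_label phi q (t : label_tree G) :
  exploration_tree phi q t -> root_label t = (q, phi).
Proof. by case: phi => [?|?|??|??] []. Qed.

(** Both bounds are proved together because negation exchanges them. At a box, the aggregate of the
    empty multiset lies below that of any children. *)
Lemma heur_admissible phi q (t : label_tree G) :
  (is_proof phi q t -> (heurI C phi <= proof_cost C t)%O) /\
  (is_disproof phi q t -> (heurJ C phi <= proof_cost C t)%O).
Proof.
elim: phi q t => [p|f IHf|a f IHf|f1 IH1 f2 IH2] q [l ds]; split.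
- by move=> [[/= -> _] _].
- by move=> [[/= -> _] _].
- by move=> [[/= -> _] [d [-> /= /(IHf _ _).2]]].
- by move=> [[/= -> _] [d [-> /= /(IHf _ _).1]]].
- by move=> [[/= -> _] _]; exact: (agg_mset0_le (hBox a)).
- move=> [[/= -> _] [d [q' [-> _ /= /(IHf _ _).2 le_d]]]].
  by rewrite seq_mset1; exact: (agg1_le (hBox a)).
- move=> [[/= -> _] [d1 [d2 [ds_eq /(IH1 _ _).1 le1 /(IH2 _ _).1 le2]]]].
  suff -> : agg_and C (seq_mset (map (proof_cost C) ds)) =
            agg_and C (seq_mset [:: proof_cost C d1; proof_cost C d2]).
    by rewrite -seq_mset2; apply: (agg_le hAnd); do !constructor.
  apply: agg_perm; case: ds_eq => -> //=.
  by rewrite (perm_catC [:: _] [:: _]).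
- move=> [[/= -> _] [d [-> dd]]] /=.
  rewrite seq_mset1 (comparable_ge_min _ (cost_comparable _ _)).
  by case: dd => [/(IH1 _ _).2|/(IH2 _ _).2] /(agg1_le hAnd) ->; rewrite ?orbT.
Qed.

(** Fresh leaves are covered by the heuristics; elsewhere monotone aggregators carry the bounds of
    the children upwards. *)
Lemma effort_admissible l n : sound l n -> forall t,
  (is_proof l.2 l.1 t -> (MPN n <= proof_cost C t)%O) /\
  (is_disproof l.2 l.1 t -> (MDN n <= proof_cost C t)%O).
Proof.
elim/expands_ind: l n => l IH n sn.
case: sn IH => [q phi|q phi i ls cs ex lscs i_eq _] IH t.
  exact: heur_admissible.
rewrite /MPN /MDN /node_info /= i_eq {i_eq}.
have {}IH : List.Forall2 (fun m c => forall t,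
    (is_proof m.2 m.1 t -> (MPN c <= proof_cost C t)%O) /\
    (is_disproof m.2 m.1 t -> (MDN c <= proof_cost C t)%O)) ls cs.
  by apply: Forall2_impl_in lscs => m c m_ls _; exact: (IH ls ex m m_ls).
case: t => lab ds; case: phi ex => [p|f|a f|f1 f2] /= ex.
- rewrite /info_term; split=> [[[/= -> _] v]|[[/= -> _] v]] /=.
    by rewrite asboolT.
  by rewrite asboolF.
- move: IH; rewrite {}ex => IH.
  inversion_clear IH as [|? c ? cs' IHc IHnil]; inversion_clear IHnil.
  split=> [[[/= -> _] [d [-> pd]]]|[[/= -> _] [d [-> pd]]]] /=.
    exact: (IHc d).2.
  exact: (IHc d).1.
- case: ex IH => s s_succ -> /Forall2_map_l /= IH; split.
    move=> [[/= -> _] [s' [s'_succ pds]]].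
    (* The proof may list the successors in another order than the search tree; its children are
       permuted to match before costs are compared one by one. *)
    have ss' : Permutation.Permutation s' s.
      apply: Permutation.NoDup_Permutation; [exact: s'_succ.1|exact: s_succ.1|].
      by move=> x; rewrite s_succ.2 s'_succ.2.
    have [ds' [dsds' {}pds]] := Permutation.Permutation_Forall2 ss' pds.
    rewrite (agg_perm _ (Permutation_perm_eq
      (Permutation.Permutation_map (proof_cost C) dsds'))).
    apply: (agg_le (hBox a)).
    elim: IH ds' pds {dsds' ss' s_succ} => [|q' c s0 cs0 IHc _ IHs] ds' pds.
      by inversion pds; constructor.
    inversion_clear pds; constructor; last exact: IHs.
    exact: (IHc _).1.
  move=> [[/= -> _] [d [q' [-> q's pd]]]] /=.
  have [c c_cs IHc] := Forall2_in_l IH ((s_succ.2 q').2 q's).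
  apply: le_trans (bigmin_cost_le _ c_cs) _.
  by rewrite seq_mset1; apply: (agg1_le (hBox a)); exact: (IHc d).2.
- move: IH; rewrite {}ex => IH; inversion_clear IH as [|? c1 ? cs' IH1 IH'].
  inversion_clear IH' as [|? c2 ? cs2 IH2 IH'']; inversion_clear IH''.
  split.
    move=> [[/= -> _] [d1 [d2 [ds_eq /(IH1 _).1 le1 /(IH2 _).1 le2]]]].
    suff -> : agg_and C (seq_mset (map (proof_cost C) ds)) =
            agg_and C (seq_mset [:: proof_cost C d1; proof_cost C d2]).
      by apply: (agg_le hAnd); do !constructor.
    apply: agg_perm; case: ds_eq => -> //=.
    by rewrite (perm_catC [:: _] [:: _]).
  move=> [[/= -> _] [d [-> dd]]] /=; rewrite seq_mset1.
  case: dd => [/(IH1 _).2|/(IH2 _).2] /(agg1_le hAnd); apply: le_trans.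
    by apply: (@bigmin_cost_le _ _ (fun c => agg_and C [mset MDN c])); left.
  by apply: (@bigmin_cost_le _ _ (fun c => agg_and C [mset MDN c])); right; left.
Qed.

(** * Extraction of optimal proofs and disproofs from solved nodes *)

Lemma pruned_all_children ls cs :
  List.Forall2 (fun l c => exists d, [/\ pruned (erase_info c) d,
    is_proof l.2 l.1 d & proof_cost C d = MPN c]) ls cs ->
  exists ds, [/\ pruned_seq (map (@erase_info _ _) cs) ds,
    List.Forall2 (fun l d => is_proof l.2 l.1 d) ls ds &
    map (proof_cost C) ds = map (@MPN _ _) cs].
Proof.
elim=> [|l c ls' cs' [d [cd pd Kd]] _ [ds [csds pds Kds]]].
  by exists [::]; split; constructor.
exists (d :: ds); split; [exact: PrunedKeep|by constructor|].
by rewrite /= Kd Kds.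
Qed.

Lemma proof_labels ls (ds : seq (label_tree G)) :
  List.Forall2 (fun l d => is_proof l.2 l.1 d) ls ds ->
  map (@root_label _) ds = ls.
Proof.
elim=> //= -[q phi] d ls' ds' /is_proof_exploration /exploration_label /= -> _ ->.
by [].
Qed.

(** The finite number of a solved node is attained. A disproof follows the child given by
    [witnessed]; a proof combines the proofs found below all children. *)
Lemma optimal_certificate l n : sound l n ->
  (MPN n = cost_oo R -> exists d, [/\ pruned (erase_info n) d,
     is_disproof l.2 l.1 d & proof_cost C d = MDN n]) /\
  (MDN n = cost_oo R -> exists d, [/\ pruned (erase_info n) d,
     is_proof l.2 l.1 d & proof_cost C d = MPN n]).
Proof.
elim/expands_ind: l n => l IH n sn.
case: sn IH => [q phi|q phi i ls cs ex lscs i_eq wit] IH.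
  have := init_leaf_unsolved q phi; rewrite solvedN => /andP[/eqP nP /eqP nD].
  by split.
have {lscs}IH := Forall2_impl_in (fun m c m_ls _ => IH ls ex m m_ls c) lscs.
have disproved c : List.In c cs -> MPN c = cost_oo R ->
    exists m d, [/\ List.In m ls, pruned_seq (map (@erase_info _ _) cs) [:: d],
      is_disproof m.2 m.1 d & proof_cost C d = MDN c].
  move=> c_cs c_oo; have [m m_ls [+ _]] := Forall2_in_r IH c_cs.
  move=> /(_ c_oo) [d [cd dd Kd]]; exists m, d; split=> //.
  by apply: pruned_seq_single cd; exact: List.in_map.
have proved : (forall c, List.In c cs -> MDN c = cost_oo R) ->
    exists ds, [/\ pruned_seq (map (@erase_info _ _) cs) ds,
      List.Forall2 (fun l d => is_proof l.2 l.1 d) ls ds &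
      map (proof_cost C) ds = map (@MPN _ _) cs].
  move=> cs_oo; apply: pruned_all_children; apply: Forall2_impl_in IH.
  by move=> m c _ c_cs [_]; apply; exact: cs_oo.
have i1 : MPN (Node (q, phi, i) cs) = (new_info C (Node (q, phi, i) cs)).1.
  by rewrite -i_eq.
have i2 : MDN (Node (q, phi, i) cs) = (new_info C (Node (q, phi, i) cs)).2.
  by rewrite -i_eq.
case: (boolP (branching phi)) => [br|]; last first.
  rewrite {}i1 {}i2; case: phi ex {i_eq wit} => [p|f|//|//] /= ex _.
    move: IH; rewrite {}ex => IH; inversion_clear IH.
    have [v|v] := pselect (valuation q p).
      rewrite /info_term asboolT //=; split=> // _.
      by exists (Node (q, Atom p) [::]); split=> //; constructor; constructor.
    rewrite /info_term asboolF //=; split=> // _.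
    by exists (Node (q, Atom p) [::]); split=> //; constructor; constructor.
  move: IH; rewrite {}ex => IH; inversion_clear IH as [|? c ? ? [cP cD] IH'].
  inversion_clear IH'.
  split=> [/cD|/cP] [d [cd pd Kd]]; exists (Node (q, Neg f) [:: d]); split=> //.
  - by do 2!constructor; last constructor.
  - split; last by exists d.
    by split=> //; right; exists d; split=> //; exact: is_proof_exploration.
  - by do 2!constructor; last constructor.
  - split; last by exists d.
    by split=> //; right; exists d; split=> //; exact: is_disproof_exploration.
split=> [P_oo|D_oo].
  have [c [/= c_cs c_oo ->]] := wit br P_oo.
  have [m [d [m_ls cd dd Kd]]] := disproved c c_cs c_oo.
  exists (Node (q, phi) [:: d]); split; first by constructor.
    case: phi ex br {i_eq wit P_oo i1 i2} => [//|//|a f|f1 f2] /= ex _.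
      rewrite /expands /= in ex; case: ex m_ls => s s_succ ->.
      move=> /List.in_map_iff [q' [mE q's]].
      rewrite -mE in dd; have q'_succ := (s_succ.2 q').1 q's.
      split; last by exists d, q'.
      split=> //; split.
        by move=> _ [<-|//]; exists q'; split=> //; exact: is_disproof_exploration dd.
      by constructor; [case|constructor].
    have {}dd : is_disproof f1 q d \/ is_disproof f2 q d.
      by move: m_ls dd; rewrite ex => -[<-|[<-|//]]; [left|right].
    split; last by exists d.
    split=> //; split=> //.
      by move=> _ [<-|//]; case: dd => /is_disproof_exploration; [left|right].
    by move=> _; constructor; [case|constructor].
  rewrite -Kd -seq_mset1; by case: (phi) br.
(* An infinite minimum forces every term to be infinite, and an aggregator gives infinity on a
   single cost only if that cost is infinite: every child is proved. *)
have {}D_oo c : List.In c cs -> MDN c = cost_oo R.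
  move=> c_cs; apply/eqP; rewrite -(agg1_eq_oo (aggregatorP phi)).
  apply/eqP/cost_oo_le; rewrite -D_oo i2 new_info_branching //=.
  exact: (bigmin_cost_le (fun c => aggregator phi [mset MDN c]) c_cs).
have [ds [csds pds Kds]] := proved D_oo.
exists (Node (q, phi) ds); split; first by constructor.
  case: phi ex br {i_eq wit D_oo i1 i2} => [//|//|a f|f1 f2] /= ex _.
    case: ex pds => s s_succ -> pds; have dsE := proof_labels pds.
    move: pds => /Forall2_map_l pds; split; last by exists s.
    split=> //; split=> [d /(Forall2_in_r pds) [q' q's pd]|].
      exists q'; split; first exact: (s_succ.2 q').1.
      exact: is_proof_exploration pd.
    (* The labels differ in their states only, and the enumeration of the successors has no
       repetition. *)
    rewrite /= dsE; apply: List.NoDup_map_NoDup_ForallPairs s_succ.1.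
    by move=> x y _ _ [].
  have dsE : map (@root_label _) ds = [:: (q, f1); (q, f2)].
    by rewrite -ex; exact: proof_labels.
  move: pds; rewrite ex => pds.
  inversion pds as [|? d1 ? ? p1 pds' e1 e2]; subst.
  inversion pds' as [|? d2 ? ? p2 pds'' e1 e2]; subst.
  inversion pds''; subst.
  split; last by exists d1, d2; split=> //; left.
  split=> //; split=> //.
    by move=> _ [<-|[<-|//]]; [left; exact: is_proof_exploration p1|
                               right; exact: is_proof_exploration p2].
  move=> f12; rewrite /= in dsE *; rewrite dsE; constructor.
    by case=> // -[] /esym.
  by constructor; [case|constructor].
by rewrite i1 new_info_branching //= -Kds; case: (phi) br.
Qed.

(** * Propagation of a change from a child to its parent *)

Lemma sound_node l q phi i cs : sound l (Node (q, phi, i) cs) -> cs <> [::] ->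
  exists ls, [/\ expands (q, phi) ls, List.Forall2 sound ls cs,
    i = new_info C (Node (q, phi, i) cs) & witnessed (Node (q, phi, i) cs)].
Proof. by move=> sn; inversion sn; subst=> // _; exists ls. Qed.

(* How an iteration may change the effort numbers of an unsolved node: a node
   that becomes solved keeps its other number, because that number was already
   the one of the child that was selected. *)
Definition progress n n' : Prop :=
  [\/ MPN n' = cost_oo R /\ MDN n' = MDN n,
      MDN n' = cost_oo R /\ MPN n' = MPN n | ~~ solved n'].

Lemma MPN_branching q phi i cs : branching phi ->
  i = new_info C (Node (q, phi, i) cs) ->
  MPN (Node (q, phi, i) cs) = aggregator phi (seq_mset (map (@MPN _ _) cs)).
Proof. by move=> br; rewrite new_info_branching // {2}/MPN => {1}->. Qed.

Lemma MDN_branching q phi i cs : branching phi ->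
  i = new_info C (Node (q, phi, i) cs) ->
  MDN (Node (q, phi, i) cs) =
    \big[Order.min/cost_oo R]_(c <- cs) aggregator phi [mset MDN c].
Proof. by move=> br; rewrite new_info_branching // {2}/MDN => {1}->. Qed.

Lemma MPN_eq_oo q phi i cs : branching phi ->
  i = new_info C (Node (q, phi, i) cs) ->
  (MPN (Node (q, phi, i) cs) == cost_oo R) =
  (cost_oo R \in map (@MPN _ _) cs).
Proof.
by move=> br i_eq; rewrite (MPN_branching br i_eq) (agg_seq_eq_oo (aggregatorP _)).
Qed.

Lemma selectable_branching phi n cs : branching phi ->
  selectable C phi n cs -> forall c, List.In c cs ->
  (aggregator phi [mset MDN n] <= aggregator phi [mset MDN c])%O.
Proof. by case: phi. Qed.

Lemma selectable_neg phi n cs : ~~ branching phi ->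
  selectable C phi n cs -> exists f, phi = Neg f.
Proof. by case: phi => // f; exists f. Qed.

(** A finite aggregate of the MPNs makes each of them finite, and the MDN of the selected child
    realises the finite minimum at the parent. *)
Lemma selected_unsolved l q phi i cs n : sound l (Node (q, phi, i) cs) ->
  List.In n cs -> selectable C phi n cs -> ~~ solved (Node (q, phi, i) cs) ->
  ~~ solved n.
Proof.
move=> sn n_cs; have cs0 : cs <> [::] by move=> e; rewrite e in n_cs.
have [ls [ex lscs i_eq _]] := sound_node sn cs0.
case: (boolP (branching phi)) => br sel.
  rewrite !solvedN (MPN_eq_oo br i_eq) (MDN_branching br i_eq).
  rewrite (bigmin_cost_eq n_cs (selectable_branching br sel)).
  rewrite (agg1_eq_oo (aggregatorP _)) => /andP[P_oo ->]; rewrite andbT.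
  apply: contraNneq P_oo => <-; elim: cs n_cs {sn cs0 lscs i_eq sel} => //= c cs IH.
  by rewrite inE => -[->|/IH ->]; rewrite ?eqxx ?orbT.
case: phi ex br sel sn i_eq => [//|f|//|//] ex _ /= -> sn i_eq.
by rewrite !solvedN /MPN /MDN /node_info /= i_eq /= andbC.
Qed.

(** The key step. No sibling is disproved, as the parent was unsolved, so the parent becomes
    disproved exactly when the replaced child does, and that child is then the required witness. *)
Lemma progress_plug l f n n' : sound l (plug f n) ->
  selectable C (frame_label f).1.2 n (frame_left f ++ n :: frame_right f) ->
  ~~ solved (plug f n) -> sound (root_label n).1 n' -> progress n n' ->
  let m := set_info (plug f n') (new_info C (plug f n')) in
  sound (frame_label f).1 m /\ progress (plug f n) m.
Proof.
case: f => -[[q phi] i] s t; rewrite /plug /set_info.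
cbn [frame_left frame_right frame_label root_label children fst snd].
set i' := new_info C _ => sn sel unsol sn' pr.
have cs0 : s ++ n :: t <> [::] by case: (s).
have [ls [ex lscs i_eq wit]] := sound_node sn cs0.
have [ls1 [ls2 [lss []]]] := List.Forall2_app_inv_r _ _ lscs.
case: ls2 => [|m ls2] lst ls_eq; inversion lst as [|? ? ? ? sm lst']; subst.
rewrite -(sound_label sm) in ex.
have lscs' : List.Forall2 sound (ls1 ++ (root_label n).1 :: ls2) (s ++ n' :: t).
  by apply: List.Forall2_app => //; constructor.
have soundI : witnessed (Node (q, phi, i') (s ++ n' :: t)) ->
    sound (q, phi) (Node (q, phi, i') (s ++ n' :: t)).
  by apply: (@SoundNode _ _ _ (ls1 ++ (root_label n).1 :: ls2)) => //.
case: (boolP (branching phi)) => br; last first.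
  have [f phi_eq] := selectable_neg br sel.
  subst phi; rewrite /= in sel.
  split; first exact: soundI.
  case: s t sel @i' unsol i_eq {soundI sn wit lscs lst lst' lscs' lss cs0}
    => [|? []] // [|//] _ i' unsol i_eq; case: pr => [[P_oo D_eq]|[D_oo P_eq]|unsol'].
  (* A negation swaps the two numbers, hence also the first two cases of [progress]. *)
  - by apply: Or32; rewrite /MPN /MDN /node_info /= i_eq.
  - by apply: Or31; rewrite /MPN /MDN /node_info /= i_eq.
  - by apply: Or33; move: unsol'; rewrite !solvedN andbC.
have i'_eq : i' = new_info C (Node (q, phi, i') (s ++ n' :: t)) by [].
have F_min := selectable_branching br sel.
have D_old : MDN (Node (q, phi, i) (s ++ n :: t)) = aggregator phi [mset MDN n].
  by rewrite (MDN_branching br i_eq) (bigmin_cost_eq (in_cat_cons _ _ _) F_min).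
have F_min' c : List.In c (s ++ n' :: t) -> c = n' \/
    (aggregator phi [mset MDN n] <= aggregator phi [mset MDN c])%O.
  move=> /List.in_app_iff [c_s|[->|c_t]]; [right|by left|right]; apply: F_min.
    by apply: List.in_or_app; left.
  by apply: List.in_or_app; right; right.
move: (unsol); rewrite solvedN (MPN_eq_oo br i_eq) D_old.
rewrite (agg1_eq_oo (aggregatorP _)) map_cat /= mem_cat inE !negb_or -!andbA.
move=> /and4P[P_s P_n P_t D_n].
have P_new : (MPN (Node (q, phi, i') (s ++ n' :: t)) == cost_oo R) =
    (MPN n' == cost_oo R).
  rewrite (MPN_eq_oo br i'_eq) map_cat /= mem_cat inE (negPf P_s) (negPf P_t).
  by rewrite orbF eq_sym.
have witI : MPN n' != cost_oo R -> witnessed (Node (q, phi, i') (s ++ n' :: t)).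
  by move=> P_n' _ /eqP; rewrite P_new (negPf P_n').
case: pr => [[P_oo D_eq]|[D_oo P_eq]|unsol'].
(* The disproved child keeps its MDN, so it still realises the minimum over all children. *)
- have D_new : MDN (Node (q, phi, i') (s ++ n' :: t)) = aggregator phi [mset MDN n'].
    rewrite (MDN_branching br i'_eq); apply: bigmin_cost_eq; first exact: in_cat_cons.
    by move=> c /F_min' [->|]; rewrite D_eq ?lexx.
  split.
    by apply: soundI => _ _; exists n'; split=> //; exact: in_cat_cons.
  apply: Or31; split; first by apply/eqP; rewrite P_new P_oo eqxx.
  by rewrite D_new D_eq D_old.
- split; first by apply/soundI/witI; rewrite P_eq eq_sym.
  (* The parent is proved if the other children have infinite MDN too; otherwise it stays unsolved.
     Its MPN is unchanged because that of the child is. *)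
  have [D_new|D_new] := eqVneq (MDN (Node (q, phi, i') (s ++ n' :: t))) (cost_oo R).
    apply: Or32; split=> //.
    by rewrite (MPN_branching br i'_eq) (MPN_branching br i_eq) !map_cat /= P_eq.
  by apply: Or33; rewrite solvedN P_new P_eq eq_sym P_n.
- move: unsol'; rewrite solvedN => /andP[P_n' D_n'].
  split; first exact/soundI/witI.
  apply: Or33; rewrite solvedN P_new P_n' -lt_cost_oo (MDN_branching br i'_eq).
  have := bigmin_cost_le (fun c => aggregator phi [mset MDN c]) (in_cat_cons n' s t).
  by move=> /le_lt_trans; apply; rewrite lt_cost_oo (agg1_eq_oo (aggregatorP _)).
Qed.

(** * The invariant along the current path and its preservation *)

(** Every node on the path must still be a legitimate selection, because an iteration resumes where
    backpropagation stopped, without descending from the root again. *)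
Fixpoint path_invariant l fs n : Prop :=
  if fs is f :: fs' then
    selectable C (frame_label f).1.2 n (frame_left f ++ n :: frame_right f) /\
    path_invariant l fs' (plug f n)
  else sound l n.

Lemma path_invariant_root l fs n :
  path_invariant l fs n -> sound l (config_root (fs, n)).
Proof. by elim: fs n => //= f fs IH n [_ /IH]. Qed.

Lemma path_invariant_sound l fs n :
  path_invariant l fs n -> sound (root_label n).1 n.
Proof.
elim: fs n => [|f fs IH] n /=; first by move=> sn; rewrite (sound_label sn).
case: f => -[[q phi] i] s t [_ /IH /sound_node]; rewrite /plug /=.
case; first by case: (s).
move=> ls [_ lscs _ _]; have [m _ mn] := Forall2_in_r lscs (in_cat_cons _ _ _).
by rewrite (sound_label mn).
Qed.

Lemma path_invariant_unsolved l fs n : path_invariant l fs n ->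
  ~~ solved (config_root (fs, n)) -> ~~ solved n.
Proof.
elim: fs n => // -[[[q phi] i] s t] fs IH n [/= sel inv] /IH -/(_ inv).
apply: selected_unsolved sel; last exact: in_cat_cons.
exact: path_invariant_sound inv.
Qed.

Lemma path_invariant_select l (c c' : config R G) :
  clos_refl_trans_1n _ (select_child C) c c' -> path_invariant l c.1 c.2 ->
  path_invariant l c'.1 c'.2 /\ config_root c' = config_root c.
Proof.
elim=> // c1 c2 c3 sel _ IH inv1.
by case: sel IH inv1 => fs q phi i s n t sel IH inv1; apply: IH; split.
Qed.

Lemma selectable_replace phi s t n n' : node_info n' = node_info n ->
  selectable C phi n (s ++ n :: t) -> selectable C phi n' (s ++ n' :: t).
Proof.
move=> info_eq; have MDN_eq : MDN n' = MDN n by rewrite /MDN info_eq.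
case: phi => //= [_|a _|_ _].
- by case: s t => [|? []] // [].
- move=> n_min c /List.in_app_iff [c_s|[<-//|c_t]]; rewrite MDN_eq; apply: n_min.
    by apply/List.in_app_iff; left.
  by apply/List.in_app_iff; right; right.
- move=> n_min c /List.in_app_iff [c_s|[<-//|c_t]]; rewrite MDN_eq; apply: n_min.
    by apply/List.in_app_iff; left.
  by apply/List.in_app_iff; right; right.
Qed.

Lemma new_info_plug f n n' : node_info n' = node_info n ->
  new_info C (plug f n') = new_info C (plug f n).
Proof.
move=> info_eq; have MPN_eq : MPN n' = MPN n by rewrite /MPN info_eq.
have MDN_eq : MDN n' = MDN n by rewrite /MDN info_eq.
case: f => -[[q phi] i] s t; rewrite /plug /=.
have map_eq : map (@MPN _ _) (s ++ n' :: t) = map (@MPN _ _) (s ++ n :: t).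
  by rewrite !map_cat /= MPN_eq.
case: phi => //= [f|a _|_ _]; first by rewrite !map_cat /= MPN_eq MDN_eq.
- congr pair; first by rewrite map_eq.
  by elim: (s) => [|c s' IH]; rewrite /= !big_cons ?IH ?MDN_eq.
- congr pair; first by rewrite map_eq.
  by elim: (s) => [|c s' IH]; rewrite /= !big_cons ?IH ?MDN_eq.
Qed.

Lemma sound_new_info l n : sound l n -> children n <> [::] ->
  node_info n = new_info C n.
Proof. by case. Qed.

(** This covers an early stop of backpropagation: selection and heredity read only the infos of
    children, so an unchanged info leaves all ancestors correct. *)
Lemma path_invariant_replace l fs n n' : path_invariant l fs n ->
  ~~ solved (config_root (fs, n)) -> sound (root_label n).1 n' ->
  node_info n' = node_info n -> path_invariant l fs n'.
Proof.
elim: fs n n' => [|f fs IH] n n' /=; first by move=> sn; rewrite (sound_label sn).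
move=> [sel inv] unsol sn' info_eq; split; first exact: selectable_replace sel.
apply: (IH (plug f n)) => //.
have new_eq := new_info_plug f info_eq.
have splug := path_invariant_sound inv.
have uplug := path_invariant_unsolved inv unsol.
have pr : progress n n'.
  apply: Or33; rewrite /solved /MPN /MDN info_eq.
  exact: (@path_invariant_unsolved l (f :: fs)).
have := (progress_plug splug sel uplug sn' pr).1.
rewrite new_eq -(sound_new_info splug); last first.
  by case: f {sel inv unsol sn' info_eq new_eq splug uplug pr} => [? []].
by case: (f) => -[[]].
Qed.

(** Here [n] is the node before the iteration, which supplies the old info and the selection
    conditions, and [n'] is its replacement. Each upward step is an instance of [progress_plug]. *)
Lemma path_invariant_backpropagate l fs n n' : path_invariant l fs n ->
  ~~ solved (config_root (fs, n)) ->
  let n'' := set_info n' (new_info C n') in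
  sound (root_label n).1 n'' -> progress n n'' ->
  let c := backpropagate C (node_info n) fs n' in path_invariant l c.1 c.2.
Proof.
elim: fs n n' => [|f fs IH] n n' inv unsol n'' sn'' pr /=.
  by rewrite -(sound_label inv).
case: eqP => [info_eq|_].
  exact: path_invariant_replace inv unsol sn'' info_eq.
case: inv => sel inv; apply: (IH (plug f n)) => //.
  have splug := path_invariant_sound inv.
  have uplug := path_invariant_unsolved inv unsol.
  exact: (progress_plug splug sel uplug sn'' pr).1.
have splug := path_invariant_sound inv.
have uplug := path_invariant_unsolved inv unsol.
exact: (progress_plug splug sel uplug sn'' pr).2.
Qed.

(** * Extension of a leaf, whole iterations and correctness of the result *)

(** An evaluated atom is solved, and so is an extended box without successors, whose MDN is an empty
    minimum. Negations and conjunctions always have children once extended. *)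
Lemma unsolved_leaf l n : sound l n -> children n = [::] -> ~~ solved n ->
  n = init_leaf C l.1 l.2.
Proof.
case=> // q phi i ls cs ex lscs i_eq _ /= cs0; move: lscs i_eq; rewrite {}cs0.
move=> lscs i_eq; inversion lscs; subst ls; rewrite solvedN /MPN /MDN /node_info /=.
rewrite {}i_eq; case: phi ex => [p|f|a f|f1 f2] //= _.
  by rewrite /info_term; case: ifP => _ /=; rewrite ?eqxx ?andbF.
by rewrite big_nil eqxx andbF.
Qed.

Lemma sound_init_leaves ls :
  List.Forall2 sound ls [seq init_leaf C m.1 m.2 | m <- ls].
Proof. by elim: ls => [|[q phi] ls IH] /=; constructor => //; exact: SoundLeaf. Qed.

(** The new children have finite numbers, so the MPN is finite and [witnessed] holds vacuously; one
    child suffices for a finite MDN. *)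
Lemma extend_branching q phi ls i
  (cs := [seq init_leaf C m.1 m.2 | m <- ls])
  (i' := new_info C (Node (q, phi, i) cs)) : branching phi ->
  expands (q, phi) ls ->
  sound (q, phi) (Node (q, phi, i') cs) /\
  (ls <> [::] -> ~~ solved (Node (q, phi, i') cs)).
Proof.
move=> br ex; have i'_eq : i' = new_info C (Node (q, phi, i') cs) by [].
have P_neq : MPN (Node (q, phi, i') cs) != cost_oo R.
  rewrite (MPN_eq_oo br i'_eq) -map_comp.
  elim: (ls) => //= m ls' IH; rewrite inE negb_or IH andbT eq_sym.
  exact: (proj1 (andP (heur_neq_oo m.2))).
split.
  apply: SoundNode ex (sound_init_leaves ls) i'_eq _.
  by move=> _ /eqP; rewrite (negPf P_neq).
rewrite solvedN P_neq -lt_cost_oo (MDN_branching br i'_eq) {P_neq ex i'_eq}.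
case: ls @cs @i' => // m ls cs _ _.
apply: (@le_lt_trans _ _ (aggregator phi [mset MDN (init_leaf C m.1 m.2)])).
  apply: (@bigmin_cost_le _ _ (fun c => aggregator phi [mset MDN c]) cs).
  by left.
rewrite lt_cost_oo (agg1_eq_oo (aggregatorP phi)).
exact: (proj2 (andP (heur_neq_oo m.2))).
Qed.

(** Two cases solve the leaf at once and need its heuristic to be exact: an atom, whose two values
    are its base cost, and a box without successors, whose [heurI] aggregates the empty multiset. *)
Lemma extend_sound q phi n' (n'' := set_info n' (new_info C n')) :
  extend C (init_leaf C q phi) n' ->
  sound (q, phi) n'' /\ progress (init_leaf C q phi) n''.
Proof.
move=> ext; move: @n''; inversion ext; subst => n''; subst.
- split; first by apply: (@SoundNode _ _ _ [::]) => //; constructor.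
  rewrite /n'' /progress /MPN /MDN /node_info /set_info /= /info_term.
  by case: ifP => _; [apply: Or32|apply: Or31].
- split.
    by apply: (@SoundNode _ _ _ [:: (q, f)]) => //; exact: sound_init_leaves [:: (q, f)].
  apply: Or33; rewrite solvedN andbC; exact: (heur_neq_oo f).
- have [sn' unsol] := @extend_branching q (And f1 f2) [:: (q, f1); (q, f2)]
    (heurI C (And f1 f2), heurJ C (And f1 f2)) isT erefl.
  by split=> //; apply: Or33; exact: unsol.
- have ex : expands (q, Box a f) [seq (q', f) | q' <- s] by exists s.
  have := @extend_branching q (Box a f) _
    (heurI C (Box a f), heurJ C (Box a f)) isT ex.
  rewrite -map_comp => -[sn' unsol]; split=> //.
  rewrite /n''; case: (s) unsol => [|q' s'] unsol.
    by apply: Or32; rewrite /MPN /MDN /= big_nil seq_mset_nil.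
  by apply: Or33; exact: unsol.
Qed.

Lemma iteration_selected_leaf l (c : config R G) fs n n' :
  path_invariant l c.1 c.2 -> ~~ solved (config_root c) ->
  clos_refl_trans_1n _ (select_child C) c (fs, n) ->
  children n = [::] -> extend C n n' ->
  [/\ path_invariant l fs n, config_root (fs, n) = config_root c &
    exists q phi, n = init_leaf C q phi].
Proof.
move=> inv unsol sel n0 ext.
have [{}inv root_eq] := path_invariant_select sel inv; split=> //.
have sn := path_invariant_sound inv.
do 2!eexists; apply: (unsolved_leaf sn n0).
by apply: (path_invariant_unsolved inv); rewrite root_eq.
Qed.

Lemma path_invariant_iteration l (c c' : config R G) :
  mps_iteration C c c' -> path_invariant l c.1 c.2 ->
  path_invariant l c'.1 c'.2.
Proof.
case=> {}c fs n n' unsol sel n0 ext inv.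
have [{}inv root_eq [q [phi n_eq]]] := iteration_selected_leaf inv unsol sel n0 ext.
subst n; have [sn' pr] := extend_sound ext.
by apply: path_invariant_backpropagate => //; rewrite root_eq.
Qed.

Lemma mps_returns_sound q phi r : mps_returns C q phi r ->
  sound (q, phi) r /\ solved r.
Proof.
move=> [c [run sol ->]]; split=> //.
suff : path_invariant (q, phi) c.1 c.2 by case: (c) => fs n /path_invariant_root.
have : path_invariant (q, phi) (mps_init C q phi).1 (mps_init C q phi).2.
  exact: SoundLeaf.
elim: run {sol} => // c1 c2 c3 it _ IH inv.
exact: IH (path_invariant_iteration it inv).
Qed.

Lemma mps_returns_minimal q phi r : mps_returns C q phi r ->
  contains_minimal C (is_proof phi q) (erase_info r) \/
  contains_minimal C (is_disproof phi q) (erase_info r).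
Proof.
move=> /mps_returns_sound [sr /orP[/eqP P_oo|/eqP D_oo]].
  right; have [d [rd dd Kd]] := (optimal_certificate sr).1 P_oo.
  by exists d; split=> // d' dd'; rewrite Kd; exact: (effort_admissible sr d').2.
left; have [d [rd pd Kd]] := (optimal_certificate sr).2 D_oo.
by exists d; split=> // d' pd'; rewrite Kd; exact: (effort_admissible sr d').1.
Qed.

(** * Termination by a decreasing measure *)

(* Empty when q has infinitely many a-successors. *)
Definition successors q a : seq (gstate G) :=
  if pselect (exists s, enumerates s (succ q a)) is left s_succ
  then sval (cid s_succ) else [::].

(* An upper bound on the number of iterations spent below a leaf (q, phi). *)
Fixpoint workload phi q : nat :=
  match phi with
  | Atom _ => 1
  | Neg f => (workload f q).+1
  | And f1 f2 => (workload f1 q + workload f2 q).+1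
  | Box a f => (sumn (map (workload f) (successors q a))).+1
  end.

(** The infos of nodes with children are not read, so updating ancestors does not affect the
    measure. *)
Fixpoint pending n : nat :=
  let: Node (q, phi, i) cs := n in
  if cs is [::] then if solved n then 0 else workload phi q
  else sumn (map pending cs).

Lemma workload_Box q a f s : enumerates s (succ q a) ->
  workload (Box a f) q = (sumn (map (workload f) s)).+1.
Proof.
move=> s_succ; rewrite /= /successors; case: pselect => [ex|[]]; last by exists s.
case: cid => s' s'_succ /=; congr _.+1; apply: perm_sumn.
apply/Permutation_perm_eq/Permutation.Permutation_map.
apply: Permutation.NoDup_Permutation; [exact: s'_succ.1|exact: s_succ.1|].
by move=> x; rewrite s_succ.2 s'_succ.2.
Qed.

Lemma pending_node lab cs : cs <> [::] ->
  pending (Node lab cs) = sumn (map pending cs).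
Proof. by case: lab => -[q phi] i; case: cs. Qed.

(** The context of the current node contributes a constant, which reduces comparisons of whole trees
    to comparisons at that node. *)
Lemma pending_root fs :
  exists k, forall n, pending (config_root (fs, n)) = k + pending n.
Proof.
elim: fs => [|f fs [k IH]]; first by exists 0.
exists (k + (sumn (map pending (frame_left f)) +
  sumn (map pending (frame_right f)))) => n.
rewrite -[config_root _]/(config_root (fs, plug f n)) IH pending_node; last first.
  by case: (frame_left f).
by rewrite map_cat sumn_cat /= -!addnA; congr addn; rewrite addnCA addnC addnA.
Qed.

Lemma pending_backpropagate old fs n :
  pending (config_root (backpropagate C old fs n)) =
  pending (config_root (fs, set_info n (new_info C n))).
Proof.
elim: fs old n => [//|f fs IH] old n /=; case: eqP => // _.
rewrite {}IH; set m := set_info n _; have [k k_eq] := pending_root fs.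
rewrite -[config_root (f :: fs, _)]/(config_root (fs, plug f m)) !k_eq.
have cs0 : frame_left f ++ m :: frame_right f <> [::] by case: (frame_left f).
by rewrite /set_info /plug !pending_node.
Qed.

Lemma pending_init_leaf q phi : pending (init_leaf C q phi) = workload phi q.
Proof. by rewrite /= (negPf (init_leaf_unsolved q phi)). Qed.

Lemma pending_extend q phi n' : extend C (init_leaf C q phi) n' ->
  pending (set_info n' (new_info C n')) < pending (init_leaf C q phi).
Proof.
rewrite pending_init_leaf => ext; inversion ext; subst.
- rewrite /= /solved /MPN /MDN /= /info_term.
  by case: asboolP => _; rewrite /= ?eqxx ?orbT.
- by rewrite pending_node //= addn0 (negPf (init_leaf_unsolved q f)).
- rewrite pending_node //= addn0.
  by rewrite (negPf (init_leaf_unsolved q f1)) (negPf (init_leaf_unsolved q f2)).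
(* Without successors the box is solved by its extension and its measure drops from 1 to 0;
   otherwise only the successor in [workload] is lost. *)
- rewrite (@workload_Box q a f s) //; case: (s) => [|q' s'].
    by rewrite /= /solved /MPN /MDN /= big_nil eqxx orbT.
  rewrite pending_node // -map_comp ltnS.
  by rewrite (eq_map (g := workload f)) // => x; rewrite /comp pending_init_leaf.
Qed.

Lemma pending_iteration l (c c' : config R G) : path_invariant l c.1 c.2 ->
  mps_iteration C c c' -> pending (config_root c') < pending (config_root c).
Proof.
move=> inv it; case: it inv => {}c fs n n' unsol sel n0 ext inv.
have [{}inv <- [q [phi n_eq]]] := iteration_selected_leaf inv unsol sel n0 ext.
rewrite pending_backpropagate; have [k k_eq] := pending_root fs.
by rewrite !k_eq ltn_add2l; subst n; exact: pending_extend.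
Qed.

Lemma exists_selectable l q phi i cs : sound l (Node (q, phi, i) cs) ->
  cs <> [::] ->
  exists s n t, cs = s ++ n :: t /\ selectable C phi n cs.
Proof.
move=> sn cs0; have [ls [ex lscs _ _]] := sound_node sn cs0.
have min_split (F : search_tree R G -> cost R) : exists s n t, cs = s ++ n :: t /\
    forall c, List.In c cs -> (F n <= F c)%O.
  have [n n_cs n_min] := exists_min_cost F cs0.
  by have [s [t cs_eq]] := List.in_split _ _ n_cs; exists s, n, t; split.
case: phi ex {sn} => [p|f|a f|f1 f2] /= ex.
- by move: lscs; rewrite ex => lscs; inversion lscs; subst.
- move: lscs; rewrite ex => lscs; inversion_clear lscs as [|? n ? t _ lst].
  by inversion_clear lst; exists [::], n, [::].
- exact: min_split.
- exact: min_split.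
Qed.

(** The descent is finite because each selection passes to a subformula; the frames are quantified
    after the node since they grow on the way. *)
Lemma exists_selection_path l n : sound l n -> ~~ solved n -> forall fs,
  exists fs' n', clos_refl_trans_1n _ (select_child C) (fs, n) (fs', n') /\
    children n' = [::].
Proof.
elim/expands_ind: l n => l IH n sn unsol fs.
have [n0|n0] := pselect (children n = [::]).
  by exists fs, n; split; [constructor|].
case: n sn unsol n0 => -[[q phi] i] cs sn unsol /= cs0.
have [s [m [t [cs_eq sel]]]] := exists_selectable sn cs0.
have [ls [ex lscs _ _]] := sound_node sn cs0.
have m_cs : List.In m cs by rewrite cs_eq; exact: in_cat_cons.
have [k k_ls km] := Forall2_in_r lscs m_cs.
have um := selected_unsolved sn m_cs sel unsol.
rewrite -(sound_label sn) /= in IH.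
have [fs' [n' [path n'0]]] := IH ls ex k k_ls m km um (Frame (q, phi, i) s t :: fs).
exists fs', n'; split=> //; rewrite cs_eq in sel *.
exact: Relation_Operators.rt1n_trans (SelectChild _ _ _ sel) path.
Qed.

Lemma exists_iteration l (c : config R G) :
  (forall q a, finite_set (succ q a)) -> path_invariant l c.1 c.2 ->
  ~~ solved (config_root c) -> exists c' : config R G, mps_iteration C c c'.
Proof.
case: c => fs n fin /= inv unsol.
have un := path_invariant_unsolved inv unsol.
have [fs' [n' [sel n'0]]] := exists_selection_path (path_invariant_sound inv) un fs.
suff [n'' ext] : exists n'', extend C n' n''.
  by exists (backpropagate C (node_info n') fs' n''); exact: MpsIteration sel n'0 ext.
case: n' n'0 {sel} => -[[q phi] i] cs /= ->.
case: phi => [p|f|a f|f1 f2]; try by eexists; constructor.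
(* Finite branching provides the list of children with which a selected box is extended. *)
have [s s_succ] := finite_enumerates (fin q a).
by eexists; exact: ExtendBox s_succ.
Qed.

Lemma mps_halts_invariant l (c : config R G) :
  (forall q a, finite_set (succ q a)) -> path_invariant l c.1 c.2 ->
  mps_halts C c.
Proof.
move=> fin; have [k] := ubnP (pending (config_root c)).
elim: k c => [|k IH] c ck inv; first by rewrite ltn0 in ck.
constructor; first exact: exists_iteration inv.
move=> c' it; apply: IH; last exact: path_invariant_iteration inv.
exact: leq_trans (pending_iteration inv it) ck.
Qed.

End Sound.

Theorem theorem2 (R : realType) (G : game_automaton) (C : cost_model R G)
    (hAnd : cost_aggregator (agg_and C))
    (hBox : forall a : agent G, cost_aggregator (agg_box C a))
    (q : gstate G) (phi : formula G) :
  (forall r : search_tree R G, mps_returns C q phi r ->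
     contains_minimal C (is_proof phi q) (erase_info r) \/
     contains_minimal C (is_disproof phi q) (erase_info r)) /\
  ((forall (q' : gstate G) (a : agent G), finite_set (succ q' a)) ->
     mps_halts C (mps_init C q phi)).
Proof.
split=> [r|fin]; first exact: mps_returns_minimal.
by apply: (mps_halts_invariant hAnd hBox fin (l := (q, phi))); exact: SoundLeaf.
Qed.
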